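(* Let $X$ be a finite set and let $M$ be a subalgebra of $\mathbb{3}^{X}$ (containing the constants $\mathbf{T},\mathbf{F},\mathbf{U}$) that is g-closed in $\mathbb{3}^{X}$, i.e. $\mathscr{A}(M) \subseteq \mathscr{A}(\mathbb{3}^{X})$. Then $M = \mathbb{3}^{X}$.
   Context: $\mathbb{3}$ denotes McCarthy's three-valued $C$-algebra on $\{T,F,U\}$ with operations: $\neg T = F$, $\neg F = T$, $\neg U = U$; $T\wedge x = x$, $F \wedge x = F$, $U \wedge x = U$; $T \vee x = T$, $F \vee x = x$, $U \vee x = U$. $\mathbb{3}^{X}$ has pointwise operations and constants $\mathbf{T},\mathbf{F},\mathbf{U}$ (constant functions). For a $C$-algebra $N$ with constants $T,F,U$, the order is $a \leq b$ iff $a \vee b = b$; an atom of $N$ is $a \neq F$ in $N$ such that every $b \in N$ with $F \leq b \leq a$, $b\ne a$ equals $F$; $\mathscr{A}(N)$ is the set of atoms of $N$. *)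

(* Defs.v *)
From HB Require Import structures.
From mathcomp Require Import all_boot.

Set Implicit Arguments.
Unset Strict Implicit.
Unset Printing Implicit Defensive.

(* C-algebras in the sense of Guzman and Squier, with constants T, F, U:
   T is the identity of conjunction, F that of disjunction, and U is fixed by
   negation. Neither binary operation is commutative in general. *)
HB.mixin Record isCAlgebra (A : Type) := {
  cT : A;
  cF : A;
  cU : A;
  cneg : A -> A;
  cand : A -> A -> A;
  cor : A -> A -> A;
  cnegK : involutive cneg;
  cneg_and : forall x y, cneg (cand x y) = cor (cneg x) (cneg y);
  candA : associative cand;
  cand_orr : right_distributive cand cor;
  cand_orl : forall x y z,
    cand (cor x y) z = cor (cand x z) (cand (cneg x) (cand y z));
  cor_andK : forall x y, cor x (cand x y) = x;
  cor_andC : forall x y,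
    cor (cand x y) (cand y x) = cor (cand y x) (cand x y);
  candTx : left_id cT cand;
  candxT : right_id cT cand;
  corFx : left_id cF cor;
  corxF : right_id cF cor;
  cnegU : cneg cU = cU
}.

#[short(type="cAlgebraType")]
HB.structure Definition CAlgebra := {A of isCAlgebra A}.

Definition cle (A : cAlgebraType) (a b : A) : Prop := cor a b = b.

Definition is_subalgebra (A : cAlgebraType) (N : {pred A}) : Prop :=
  [/\ [/\ cT \in N, cF \in N & cU \in N],
      forall a, a \in N -> cneg a \in N,
      forall a b, a \in N -> b \in N -> cand a b \in N
    & forall a b, a \in N -> b \in N -> cor a b \in N].

(* N stands for a subalgebra of A, with the operations and the order inherited
   from A; the atoms of A itself are is_atom predT. *)
Definition is_atom (A : cAlgebraType) (N : {pred A}) (a : A) : Prop :=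
  [/\ a \in N, a <> cF
    & forall b, b \in N -> cle cF b -> cle b a -> b <> a -> b = cF].

Definition g_closed (A : cAlgebraType) (M : {pred A}) : Prop :=
  forall a, is_atom M a -> is_atom (predT : {pred A}) a.

Inductive three : Type := T3 | F3 | U3.

Definition option_bool_of_three (x : three) : option bool :=
  match x with T3 => Some true | F3 => Some false | U3 => None end.

Definition three_of_option_bool (x : option bool) : three :=
  match x with Some true => T3 | Some false => F3 | None => U3 end.

Lemma option_bool_of_threeK :
  cancel option_bool_of_three three_of_option_bool.
Proof. by case. Qed.

HB.instance Definition _ := Finite.copy three (can_type option_bool_of_threeK).

Definition neg3 (x : three) : three :=
  match x with T3 => F3 | F3 => T3 | U3 => U3 end.

Definition and3v (x y : three) : three :=
  match x with T3 => y | F3 => F3 | U3 => U3 end.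

Definition or3v (x y : three) : three :=
  match x with T3 => T3 | F3 => y | U3 => U3 end.

Fact neg3K : involutive neg3. Proof. by case. Qed.
Fact neg3_and x y : neg3 (and3v x y) = or3v (neg3 x) (neg3 y).
Proof. by case: x. Qed.
Fact and3vA : associative and3v. Proof. by case. Qed.
Fact and3v_orr : right_distributive and3v or3v. Proof. by case. Qed.
Fact and3v_orl x y z :
  and3v (or3v x y) z = or3v (and3v x z) (and3v (neg3 x) (and3v y z)).
Proof. by case: x; case: y; case: z. Qed.
Fact or3v_andK x y : or3v x (and3v x y) = x. Proof. by case: x. Qed.
Fact or3v_andC x y :
  or3v (and3v x y) (and3v y x) = or3v (and3v y x) (and3v x y).
Proof. by case: x; case: y. Qed.
Fact and3vTx : left_id T3 and3v. Proof. by case. Qed.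
Fact and3vxT : right_id T3 and3v. Proof. by case. Qed.
Fact or3vFx : left_id F3 or3v. Proof. by case. Qed.
Fact or3vxF : right_id F3 or3v. Proof. by case. Qed.
Fact neg3U : neg3 U3 = U3. Proof. by []. Qed.

HB.instance Definition _ := isCAlgebra.Build three
  neg3K neg3_and and3vA and3v_orr and3v_orl or3v_andK or3v_andC
  and3vTx and3vxT or3vFx or3vxF neg3U.

Definition ffun_cT (X : finType) (A : cAlgebraType) : {ffun X -> A} :=
  [ffun=> cT].
Definition ffun_cF (X : finType) (A : cAlgebraType) : {ffun X -> A} :=
  [ffun=> cF].
Definition ffun_cU (X : finType) (A : cAlgebraType) : {ffun X -> A} :=
  [ffun=> cU].
Definition ffun_cneg (X : finType) (A : cAlgebraType) (f : {ffun X -> A}) :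
  {ffun X -> A} := [ffun x => cneg (f x)].
Definition ffun_cand (X : finType) (A : cAlgebraType) (f g : {ffun X -> A}) :
  {ffun X -> A} := [ffun x => cand (f x) (g x)].
Definition ffun_cor (X : finType) (A : cAlgebraType) (f g : {ffun X -> A}) :
  {ffun X -> A} := [ffun x => cor (f x) (g x)].

Fact ffun_cnegK (X : finType) (A : cAlgebraType) :
  involutive (@ffun_cneg X A).
Proof. by move=> f; apply/ffunP=> x; rewrite !ffunE cnegK. Qed.
Fact ffun_cneg_and (X : finType) (A : cAlgebraType) (f g : {ffun X -> A}) :
  ffun_cneg (ffun_cand f g) = ffun_cor (ffun_cneg f) (ffun_cneg g).
Proof. by apply/ffunP=> x; rewrite !ffunE cneg_and. Qed.
Fact ffun_candA (X : finType) (A : cAlgebraType) :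
  associative (@ffun_cand X A).
Proof. by move=> f g h; apply/ffunP=> x; rewrite !ffunE candA. Qed.
Fact ffun_cand_orr (X : finType) (A : cAlgebraType) :
  right_distributive (@ffun_cand X A) (@ffun_cor X A).
Proof. by move=> f g h; apply/ffunP=> x; rewrite !ffunE cand_orr. Qed.
Fact ffun_cand_orl (X : finType) (A : cAlgebraType) (f g h : {ffun X -> A}) :
  ffun_cand (ffun_cor f g) h =
  ffun_cor (ffun_cand f h) (ffun_cand (ffun_cneg f) (ffun_cand g h)).
Proof. by apply/ffunP=> x; rewrite !ffunE cand_orl. Qed.
Fact ffun_cor_andK (X : finType) (A : cAlgebraType) (f g : {ffun X -> A}) :
  ffun_cor f (ffun_cand f g) = f.
Proof. by apply/ffunP=> x; rewrite !ffunE cor_andK. Qed.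
Fact ffun_cor_andC (X : finType) (A : cAlgebraType) (f g : {ffun X -> A}) :
  ffun_cor (ffun_cand f g) (ffun_cand g f) =
  ffun_cor (ffun_cand g f) (ffun_cand f g).
Proof. by apply/ffunP=> x; rewrite !ffunE cor_andC. Qed.
Fact ffun_candTx (X : finType) (A : cAlgebraType) :
  left_id (@ffun_cT X A) (@ffun_cand X A).
Proof. by move=> f; apply/ffunP=> x; rewrite !ffunE candTx. Qed.
Fact ffun_candxT (X : finType) (A : cAlgebraType) :
  right_id (@ffun_cT X A) (@ffun_cand X A).
Proof. by move=> f; apply/ffunP=> x; rewrite !ffunE candxT. Qed.
Fact ffun_corFx (X : finType) (A : cAlgebraType) :
  left_id (@ffun_cF X A) (@ffun_cor X A).
Proof. by move=> f; apply/ffunP=> x; rewrite !ffunE corFx. Qed.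
Fact ffun_corxF (X : finType) (A : cAlgebraType) :
  right_id (@ffun_cF X A) (@ffun_cor X A).
Proof. by move=> f; apply/ffunP=> x; rewrite !ffunE corxF. Qed.
Fact ffun_cnegU (X : finType) (A : cAlgebraType) :
  ffun_cneg (@ffun_cU X A) = @ffun_cU X A.
Proof. by apply/ffunP=> x; rewrite !ffunE cnegU. Qed.

HB.instance Definition _ (X : finType) (A : cAlgebraType) :=
  isCAlgebra.Build {ffun X -> A}
    (@ffun_cnegK X A) (@ffun_cneg_and X A) (@ffun_candA X A)
    (@ffun_cand_orr X A) (@ffun_cand_orl X A) (@ffun_cor_andK X A)
    (@ffun_cor_andC X A) (@ffun_candTx X A) (@ffun_candxT X A)
    (@ffun_corFx X A) (@ffun_corxF X A) (@ffun_cnegU X A).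

(* Main.v *)
Require Import Defs.
From HB Require Import structures.
From mathcomp Require Import all_boot.

Set Implicit Arguments.
Unset Strict Implicit.
Unset Printing Implicit Defensive.

(** In [3^X], [a <= b] says that [a] arises from [b] by replacing some values by
    [F], so an atom of [3^X] is [F] except at one point. If the indicator of [Y]
    lies in [M], an atom of [M] below it is by g-closedness the indicator of a
    single point of [Y], which can be removed from [Y] by conjunction with its
    negation. Descending from [T] to any prescribed point [x], [M] contains the
    indicator of [{x}], hence, by conjunction with [U], also the function with
    value [U] at [x] and [F] elsewhere. Every function is a finite disjunction
    of these. *)

Section Restriction.

Variable X : finType.
Implicit Types (f g : {ffun X -> three}) (P : pred X).

(** With [f := cT] this is the indicator of [P]. *)
Definition restrict P f : {ffun X -> three} :=
  [ffun x => if P x then f x else F3].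

Lemma cleP f g :
  reflect (forall x, f x = F3 \/ f x = g x) (cor f g == g).
Proof.
apply: (iffP eqP) => [/ffunP fg x | fg].
  have := fg x; rewrite ffunE /cor /=.
  by case: (f x) => /= [||]; auto.
apply/ffunP=> x; rewrite ffunE; have [->|->] := fg x; first by rewrite corFx.
by case: (g x).
Qed.

Lemma cle_restrict P f : cle (restrict P f) f.
Proof. by apply/eqP/cleP=> x; rewrite ffunE; case: ifP; auto. Qed.

(** Cutting [f] down to a point where it is not [F3] gives a nonzero element below [f], which
    minimality identifies with [f]. *)
Lemma atom_ffunP f :
  is_atom (predT : {pred {ffun X -> three}}) f ->
  exists2 x, f x != F3 & f = restrict (pred1 x) f.
Proof.
case=> _ fN0 fmin.
have [x fx] : exists x, f x != F3.
  apply/existsP; apply: contra_notT fN0; rewrite negb_exists => /forallP f0.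
  by apply/ffunP=> x; rewrite ffunE; apply/eqP; rewrite -[_ == _]negbK f0.
exists x => //; case: (restrict (pred1 x) f =P f) => [-> // | neq].
have := fmin (restrict (pred1 x) f) isT (corFx _) (cle_restrict _ _) neq.
by move/ffunP/(_ x)/eqP; rewrite !ffunE /= eqxx (negPf fx).
Qed.

(** Among the nonzero elements of [M] below [f], one of smallest support is an atom: going strictly
    down in the order loses support. *)
Lemma exists_atom (M : {set {ffun X -> three}}) f :
  f \in M -> f <> cF -> exists2 p, is_atom (mem M) p & cle p f.
Proof.
move=> fM /eqP fN0.
pose good g := [&& g \in M, g != cF & cor g f == f].
have good_f : good f.
  by rewrite /good fM fN0; apply/cleP=> x; right.
case: (arg_minnP (fun g => #|[pred x | g x != F3]|) good_f).
move=> p /and3P[pM /eqP pN0 pf] pmin.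
exists p; last exact/eqP.
split=> // b bM _ /eqP/cleP bp b_p.
apply/eqP; apply: contra_notT b_p => bN0.
have /pmin le_pb : good b.
  rewrite /good bM bN0; apply/cleP=> x.
  by have [|->] := bp x; [left | exact: (elimT (cleP _ _) pf)].
have sub_bp : [pred x | b x != F3] \subset [pred x | p x != F3].
  by apply/subsetP=> x; rewrite !inE; have [->|->] := bp x.
have /subset_cardP eq_bp : #|[pred x | b x != F3]| = #|[pred x | p x != F3]|.
  by apply/eqP; rewrite eqn_leq le_pb subset_leq_card.
apply/ffunP=> x; have [bx0|//] := bp x.
have := eq_bp sub_bp x; rewrite !inE bx0 eqxx /=.
by move/esym/negbFE/eqP.
Qed.

End Restriction.

Section Generation.

Variables (X : finType) (M : {set {ffun X -> three}}).
Hypotheses (subM : is_subalgebra (mem M)) (gM : g_closed (mem M)).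

Lemma indicator1_mem (x : X) : restrict (pred1 x) cT \in M.
Proof.
have [[TM _ _] negM andM _] := subM.
(* Which point of [Y] the atom selects is not controlled, hence the induction on a bound for [#|Y|]:
   a point other than [x] is discarded. *)
suff descent n : forall Y : {set X}, #|Y| <= n -> x \in Y ->
    restrict (mem Y) cT \in M -> restrict (pred1 x) cT \in M.
  apply: (descent #|[set: X]| [set: X]); rewrite ?inE //.
  suff -> : restrict (mem [set: X]) cT = cT by [].
  by apply/ffunP=> y; rewrite ffunE /= inE.
elim: n => [|n IHn] Y leYn xY YM.
  by move: leYn; rewrite leqn0 cards_eq0 => /eqP Y0; rewrite Y0 inE in xY.
have YN0 : restrict (mem Y) cT <> cF.
  by move/ffunP/(_ x); rewrite !ffunE /= xY.
have [p atom_p /eqP/cleP leq_pY] := exists_atom YM YN0.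
have pM : p \in M by case: atom_p.
have [y py def_p] := atom_ffunP (gM atom_p).
(* Below an indicator only the values [F3] and [T3] occur, so [U3] is excluded. *)
have [yY pyT] : y \in Y /\ p y = T3.
  have [py0 | ->] := leq_pY y; first by rewrite py0 eqxx in py.
  move: (leq_pY y) py; rewrite !ffunE /=.
  by case: (y \in Y) => // -[] ->.
have {}def_p : p = restrict (pred1 y) cT.
  by rewrite def_p; apply/ffunP=> z; rewrite !ffunE /=; case: eqP => // ->.
have [<-|neq_yx] := eqVneq y x; first by rewrite -def_p.
apply: (IHn (Y :\ y)).
- by move: leYn; rewrite (cardsD1 y Y) yY.
- by rewrite !inE eq_sym neq_yx.
have -> : restrict (mem (Y :\ y)) cT = cand (cneg p) (restrict (mem Y) cT).
  apply/ffunP=> z; rewrite def_p !ffunE /= !inE.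
  by case: (z == y); case: (z \in Y).
by apply: andM => //; apply: negM.
Qed.

Lemma restrict1_mem (x : X) (f : {ffun X -> three}) :
  restrict (pred1 x) f \in M.
Proof.
have [[_ FM UM] _ andM _] := subM.
have xM := indicator1_mem x.
case fx: (f x).
- suff -> : restrict (pred1 x) f = restrict (pred1 x) cT by [].
  by apply/ffunP=> y; rewrite !ffunE /=; case: eqP => // ->.
- suff -> : restrict (pred1 x) f = cF by [].
  by apply/ffunP=> y; rewrite !ffunE /=; case: eqP => // ->.
(* The order of the factors matters: with [cU] on the left the result would be [cU] everywhere. *)
suff -> : restrict (pred1 x) f = cand (restrict (pred1 x) cT) cU by apply: andM.
by apply/ffunP=> y; rewrite !ffunE /=; case: eqP => // ->.
Qed.

Lemma restrict_mem (s : seq X) (f : {ffun X -> three}) :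
  restrict (mem s) f \in M.
Proof.
have [[_ FM _] _ _ orM] := subM.
elim: s => [|x s IHs].
  suff -> : restrict (mem [::]) f = cF by [].
  by apply/ffunP=> y; rewrite !ffunE.
suff -> : restrict (mem (x :: s)) f
          = cor (restrict (pred1 x) f) (restrict (mem s) f).
  by apply: orM => //; apply: restrict1_mem.
(* Repetitions in the list are harmless, since [cor] is idempotent. *)
apply/ffunP=> y; rewrite !ffunE /= inE.
by case: (y == x); case: (y \in s); case: (f y).
Qed.

End Generation.

Theorem theorem2p42 (X : finType) (M : {set {ffun X -> three}}) :
  is_subalgebra (mem M) -> g_closed (mem M) -> M = [set: {ffun X -> three}].
Proof.
move=> subM gM; apply/setP=> f; rewrite inE.
suff <- : restrict (mem (enum X)) f = f by apply: restrict_mem.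
by apply/ffunP=> x; rewrite ffunE /= mem_enum.
Qed.
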